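(* Let $a,b\in R^{WD}$, and let $a^{WD}$, $b^{WD}$ be WD inverses of $a$ and $b$ respectively. If $ab=ba$ and $ba^{WD}a=a^{WD}ab$, then $ab$ is WD invertible and $b^{WD}a^{WD}$ is a WD inverse of $ab$, i.e. $(ab)^{WD}=b^{WD}a^{WD}$.
   Context: $R$ is a proper unital ring with involution: an associative ring with $1$ and a map $*:R\to R$ with $(a+b)^*=a^*+b^*$, $(ab)^*=b^*a^*$, $(a^* )^*=a$, such that $a^*a=0$ implies $a=0$. Weak Drazin (WD) inverse: $a\in R$ is WD invertible if there are $x\in R$ and a positive integer $k$ with $axa=a$, $a^{k+1}x=a^k$, $xa^{k+1}=a^k$. The least positive integer $k$ for which such an $x$ exists is the weak Drazin index $\mathrm{ind}(a)$; any $x$ satisfying the three equations with $k=\mathrm{ind}(a)$ is a WD inverse of $a$ (not unique in general), denoted $a^{WD}$. $R^{WD}$ is the set of WD invertible elements. *)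

(* Defs.v *)
From mathcomp Require Import all_boot all_order all_algebra.
Set Implicit Arguments.
Unset Strict Implicit.
Unset Printing Implicit Defensive.
Import GRing.Theory.
Local Open Scope ring_scope.

Record involution (R : pzRingType) (star : R -> R) : Prop := Involution {
  involution_add : {morph star : x y / x + y};
  involution_mul : forall x y : R, star (x * y) = star y * star x;
  involution_invol : involutive star
}.

Definition proper_involution (R : pzRingType) (star : R -> R) : Prop :=
  involution star /\ forall x : R, star x * x = 0 -> x = 0.

Definition WD_equations (R : pzRingType) (a x : R) (k : nat) : Prop :=
  [/\ a * x * a = a, a ^+ k.+1 * x = a ^+ k & x * a ^+ k.+1 = a ^+ k].

Definition WD_invertible (R : pzRingType) (a : R) : Prop :=
  exists (x : R) (k : nat), (0 < k)%N /\ WD_equations a x k.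

(* The weak Drazin index is given by its graph: [k] is the index of [a]. *)
Definition is_WD_index (R : pzRingType) (a : R) (k : nat) : Prop :=
  [/\ (0 < k)%N,
      exists x : R, WD_equations a x k
    & forall j : nat, (0 < j)%N -> (exists x : R, WD_equations a x j) ->
      (k <= j)%N].

Definition is_WD_inverse (R : pzRingType) (a x : R) : Prop :=
  exists k : nat, is_WD_index a k /\ WD_equations a x k.

(* Main.v *)
Require Import Defs.
From mathcomp Require Import all_boot all_order all_algebra.
From Stdlib Require Import Classical.
Set Implicit Arguments.
Unset Strict Implicit.
Unset Printing Implicit Defensive.
Import GRing.Theory.
Local Open Scope ring_scope.

(** If [a] and [b] satisfy the WD equations with a common exponent [m], a direct
    computation with [c = a b] shows that [w = bWD aWD] satisfies them for [c]
    with exponent [m]. The index [p] of [c] may be smaller than [m], but a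
    solution [z] at [p] gives [c^p = z^j c^(p+j) = c^(p+j) z^j], which brings
    the equations for [w] from exponent [m] down to [p]. *)

(** Solvability of the WD equations at a given exponent need not be decidable in a general ring, so
    excluded middle drives the descent to the index. *)
Lemma ex_min_prop (P : nat -> Prop) :
  (exists n, P n) -> exists n, P n /\ forall j, P j -> (n <= j)%N.
Proof.
case=> n; elim/ltn_ind: n => n IHn Pn.
have [[j [lt_jn Pj]]|no_less] := classic (exists j, (j < n)%N /\ P j).
  exact: IHn Pj.
exists n; split=> // j Pj; rewrite leqNgt; apply/negP=> lt_jn.
by apply: no_less; exists j.
Qed.

Section WeakDrazin.
Variable R : pzRingType.
Implicit Types a b c w x y z : R.

Lemma WD_equations_leq a x k m :
  (k <= m)%N -> WD_equations a x k -> WD_equations a x m.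
Proof.
move=> /subnK <- [axa akx xak]; split=> //.
  by rewrite -addnS exprD -mulrA akx -exprD.
by rewrite addnC -addSn exprD mulrA xak -exprD.
Qed.

Lemma WD_equations_expl c z p j :
  WD_equations c z p -> z ^+ j * c ^+ (p + j) = c ^+ p.
Proof.
case=> _ _ zc; elim: j => [|j IHj]; first by rewrite expr0 mul1r addn0.
by rewrite exprSr addnS -addSn exprD -mulrA [z * _]mulrA zc -exprD.
Qed.

Lemma WD_equations_expr c z p j :
  WD_equations c z p -> c ^+ (j + p) * z ^+ j = c ^+ p.
Proof.
case=> _ cz _; elim: j => [|j IHj]; first by rewrite expr0 mulr1.
by rewrite exprS addSn -addnS exprD mulrA -[_ * _ * z]mulrA cz -exprD.
Qed.

Lemma WD_equations_exchange c w z m p : (p <= m)%N ->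
  WD_equations c z p -> WD_equations c w m -> WD_equations c w p.
Proof.
move=> /subnKC le_pm czp [cwc cw wc]; split=> //.
  (* Both sides acquire the left factor [z ^+ (m - p)], away from [w]; what remains is [cw]. The
     other equation is the mirror image. *)
  rewrite exprSr -(WD_equations_expl (m - p) czp) le_pm.
  by rewrite -(mulrA _ _ c) -exprSr -mulrA cw.
rewrite exprS -(WD_equations_expr (m - p) czp) addnC le_pm.
by rewrite (mulrA c) -exprS mulrA wc.
Qed.

Lemma WD_equations_is_WD_inverse c w m :
  (0 < m)%N -> WD_equations c w m -> is_WD_inverse c w.
Proof.
move=> m_gt0 cwm.
(* The index [p] comes with its own solution [z], possibly different from [w]. *)
have [|p [[p_gt0 [z czp]] p_min]] :=
    @ex_min_prop (fun j => (0 < j)%N /\ exists x, WD_equations c x j).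
  by exists m; split=> //; exists w.
exists p; split; first by split; [|exists z|move=> j j_gt0 cj; apply: p_min].
apply: (WD_equations_exchange _ czp cwm).
by apply: p_min; split=> //; exists w.
Qed.

Lemma WD_equations_mul a b x y m : a * b = b * a -> b * x * a = x * a * b ->
  WD_equations a x m -> WD_equations b y m -> WD_equations (a * b) (y * x) m.
Proof.
move=> ab bxa [axa ax xa] [byb yb bb].
have abX i j : a ^+ i * b ^+ j = b ^+ j * a ^+ i.
  by apply: commrX; apply/commr_sym/commrX/commr_sym.
have abM i : (a * b) ^+ i = a ^+ i * b ^+ i by apply: exprMn_comm.
split.
- have -> : a * b * (y * x) * (a * b) = a * (b * y * (x * a * b)).
    by rewrite !mulrA.
  (* Read backwards, [bxa] brings [b] next to [b * y], so that [byb] applies; read forwards, it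
     returns [b] to the right and leaves [a * x * a]. *)
  by rewrite -bxa !mulrA -(mulrA a b y) -(mulrA a _ b) byb -!mulrA
    (mulrA b) bxa !mulrA axa.
(* Once [y] is absorbed by the power of [b], commuting the powers lets that of [a] meet [x]. *)
- by rewrite !abM mulrA -(mulrA (a ^+ _)) yb abX -mulrA ax -abX.
- by rewrite !abM -mulrA (mulrA x) xa abX mulrA bb -abX.
Qed.

End WeakDrazin.

Theorem theorem3p3 (R : pzRingType) (star : R -> R)
    (Rproper : proper_involution star)
    (a b aWD bWD : R)
    (a_inv : WD_invertible a) (b_inv : WD_invertible b)
    (aWD_inverse : is_WD_inverse a aWD) (bWD_inverse : is_WD_inverse b bWD)
    (ab_comm : a * b = b * a)
    (b_comm : b * aWD * a = aWD * a * b) :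
  WD_invertible (a * b) /\ is_WD_inverse (a * b) (bWD * aWD).
Proof.
have [k [[k_gt0 _ _] ak]] := aWD_inverse.
have [l [_ bl]] := bWD_inverse.
(* The equations persist at larger exponents, so the maximum of the two indices serves both
   elements. *)
have m_gt0 : (0 < maxn k l)%N by rewrite leq_max k_gt0.
have abm : WD_equations (a * b) (bWD * aWD) (maxn k l).
  apply: WD_equations_mul => //.
    exact: WD_equations_leq (leq_maxl k l) ak.
  exact: WD_equations_leq (leq_maxr k l) bl.
split; last exact: WD_equations_is_WD_inverse m_gt0 abm.
by exists (bWD * aWD), (maxn k l).
Qed.
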